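(* Let $G$ be a connected $k$-regular graph with $n$ vertices and $m$ edges, where $m\ge n$. Let $G_1$ and $G_2$ be two arbitrary graphs with $n_1\ge1$ and $n_2\ge1$ vertices, respectively. Then the Laplacian spectrum of the total double join $G^T\vee(G_1^\bullet,G_2^\circ)$ consists of: (i) $\lambda_i(G_1)+n$, for $i=2,3,\ldots,n_1$; (ii) $\lambda_i(G_2)+m$, for $i=2,3,\ldots,n_2$; (iii) $\dfrac{(n_1+2\lambda_i(G)+k+n_2+2)\pm\sqrt{(n_1+k-n_2-2)^2+4(2k-\lambda_i(G))}}{2}$, for $i=2,3,\ldots,n$; (iv) $n_2+2k+2$, repeated $m-n$ times; (v) the four roots of the equation $$\begin{aligned}\lambda\bigl(&\lambda^3-(m+n+n_1+k+n_2+2)\lambda^2+(2m+(n_1+k+n)(m+n_2+2)+nk-2k)\lambda\\&+2(n+m)k-2(n_1+k+n)m-nk(m+n_2+2)\bigr)=0.\end{aligned}$$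
   Context: All graphs are finite and simple. The Laplacian matrix of a graph $H$ is $L(H)=D(H)-A(H)$, where $A(H)$ is the adjacency matrix and $D(H)$ the diagonal matrix of vertex degrees. The Laplacian spectrum of $H$ is the list of all eigenvalues of $L(H)$ counted with multiplicity; if $H$ has $N$ vertices they are written $\lambda_1(H)\le\lambda_2(H)\le\cdots\le\lambda_N(H)$. The total graph $T(G)$ is the graph whose vertex set is the (disjoint) union of the vertex set and the edge set of $G$, two vertices of $T(G)$ being adjacent whenever the two corresponding elements of $G$ are incident or adjacent; let $I(G)$ be the set of vertices of $T(G)$ corresponding to edges of $G$. The total double join $G^T\vee(G_1^\bullet,G_2^\circ)$ is the graph obtained from the disjoint union of $T(G)$, $G_1$ and $G_2$ by joining every vertex of $T(G)$ corresponding to a vertex of $G$ to every vertex of $G_1$ and every vertex of $I(G)$ to every vertex of $G_2$. *)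

(* Defs.v *)
From HB Require Import structures.
From mathcomp Require Import all_boot all_order all_algebra.
From mathcomp Require Import polyrcf.

Set Implicit Arguments.
Unset Strict Implicit.
Unset Printing Implicit Defensive.

Import Order.TTheory GRing.Theory Num.Theory.
Local Open Scope ring_scope.

Record sgraph := SGraph {
  vertex :> finType;
  adj : rel vertex;
  adj_sym : symmetric adj;
  adj_irrefl : irreflexive adj }.

Section Graph.
Variable G : sgraph.

Definition degree (x : G) : nat := #|[set y | adj x y]|.

Definition regular (k : nat) : Prop := forall x : G, degree x = k.

(* The graph without vertices is not connected. *)
Definition connected_graph : Prop :=
  (0 < #|G|)%N /\ forall x y : G, connect (@adj G) x y.

Definition edge_set : {set {set G}} :=
  [set A | [exists x, exists y, adj x y && (A == [set x; y])]].

Definition edge : finType := {A : {set G} | A \in edge_set}.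

Definition total_adj (u v : G + edge) : bool :=
  match u, v with
  | inl x, inl y => adj x y
  | inl x, inr a => x \in val a
  | inr a, inl x => x \in val a
  | inr a, inr b => (a != b) && (val a :&: val b != set0)
  end.

Lemma total_adj_sym : symmetric total_adj.
Proof.
case=> [x|a] [y|b] //=; first exact: adj_sym.
by rewrite eq_sym setIC.
Qed.

Lemma total_adj_irrefl : irreflexive total_adj.
Proof. by case=> [x|a] /=; [exact: adj_irrefl | rewrite eqxx]. Qed.

Definition total_graph : sgraph := SGraph total_adj_sym total_adj_irrefl.

End Graph.

Section TotalDoubleJoin.
Variables G G1 G2 : sgraph.

Definition tdjoin_adj (u v : total_graph G + (G1 + G2)) : bool :=
  match u, v with
  | inl s, inl t => adj s t
  | inr (inl y), inr (inl z) => adj y z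
  | inr (inr y), inr (inr z) => adj y z
  | inl (inl _), inr (inl _) | inr (inl _), inl (inl _) => true
  | inl (inr _), inr (inr _) | inr (inr _), inl (inr _) => true
  | _, _ => false
  end.

Lemma tdjoin_adj_sym : symmetric tdjoin_adj.
Proof.
case=> [[x|a]|[y|y]] [[x'|a']|[z|z]] //=; try exact: adj_sym.
by rewrite eq_sym setIC.
Qed.

Lemma tdjoin_adj_irrefl : irreflexive tdjoin_adj.
Proof. by case=> [[x|a]|[y|y]] /=; rewrite ?adj_irrefl ?eqxx. Qed.

Definition total_double_join : sgraph :=
  SGraph tdjoin_adj_sym tdjoin_adj_irrefl.

End TotalDoubleJoin.

Section Spectrum.
Variable R : rcfType.

Definition adjacency_mx (H : sgraph) : 'M[R]_#|H| :=
  \matrix_(i, j) (adj (enum_val i : H) (enum_val j))%:R.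

Definition degree_mx (H : sgraph) : 'M[R]_#|H| :=
  diag_mx (\row_i (degree (enum_val i : H))%:R).

Definition laplacian_mx (H : sgraph) : 'M[R]_#|H| :=
  degree_mx H - adjacency_mx H.

(* All roots of p in R in nondecreasing order, each repeated according to its
   multiplicity ([::] if p = 0). *)
Definition roots_mult (p : {poly R}) : seq R :=
  sort <=%R (flatten [seq nseq (mup x p) x | x <- rootsR p]).

(* As the Laplacian matrix is real symmetric, its eigenvalues all lie in R. *)
Definition laplacian_spectrum (H : sgraph) : seq R :=
  roots_mult (char_poly (laplacian_mx H)).

(* Eigenvalues are numbered from 1. *)
Definition lambda (H : sgraph) (i : nat) : R :=
  nth 0 (laplacian_spectrum H) i.-1.

End Spectrum.

(* Main.v *)
Require Import Defs.
From HB Require Import structures.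
From mathcomp Require Import all_boot all_order all_algebra.
From mathcomp Require Import perm spectral sesquilinear polyrcf complex ring lra.
Import Order.TTheory GRing.Theory Num.Theory.
Local Open Scope ring_scope.

Set Implicit Arguments.
Unset Strict Implicit.
Unset Printing Implicit Defensive.

(* Let B be the incidence matrix and L the Laplacian of G. As G is k-regular,
   B B^T = 2k - L, and the line graph of G has adjacency matrix B^T B - 2.
   For x < 0 the value at x of the characteristic polynomial of the join is
   computed by two block eliminations, one removing G1 and G2 and one removing
   the edges; the latter yields the factor (x - n2 - 2k - 2)^(m - n) because
   det(b + B^T X) b^n = b^m det(b + X B^T). What is left is the determinant of a
   quadratic polynomial in L plus a multiple of the all-ones matrix. For x < 0
   that quadratic has real roots, so its determinant is read off the spectrum
   of L; seen as a quadratic in x, the factor of an eigenvalue of L has the two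
   roots (iii), which are real because the eigenvalues of L are at most 2k. *)

(** * Multiplicities in the sorted list of roots of a polynomial *)

Section Roots.
Variable R : rcfType.
Implicit Types p q : {poly R}.

(** [rootsR p] has no duplicates, so at most one block of the flattened list contains [a]. Multisets
    of roots can then be compared through [mup]. *)
Lemma count_roots_mult p a : p != 0 -> count_mem a (roots_mult p) = mup a p.
Proof.
move=> p0; rewrite (seq.permP (permEl (perm_sort _ _))).
have rU : uniq (rootsR p) by apply: uniq_roots.
have rP : (a \in rootsR p) = root p a.
  by have := roots_on_rootsR p0 a; rewrite in_itv /= => <-.
have -> s : count_mem a (flatten [seq nseq (mup x p) x | x <- s])
          = (count_mem a s * mup a p)%N.
  elim: s => //= x s IHs; rewrite count_cat IHs count_nseq mulnDl /=.
  by have [->|] := eqVneq x a.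
rewrite count_uniq_mem // rP; case: (boolP (root p a)) => [_|/mupNroot ->//].
by rewrite mul1n.
Qed.

Lemma perm_roots_multM p q : p != 0 -> q != 0 ->
  perm_eq (roots_mult (p * q)) (roots_mult p ++ roots_mult q).
Proof.
move=> p0 q0; apply/allP => a _ /=.
by rewrite count_cat !count_roots_mult ?mulf_neq0 // mupM.
Qed.

Lemma perm_roots_mult_prod (s : seq R) :
  perm_eq (roots_mult (\prod_(a <- s) ('X - a%:P))) s.
Proof.
apply/allP => a _ /=.
by rewrite count_roots_mult ?mu_prod_XsubC // monic_neq0 ?monic_prod_XsubC.
Qed.
End Roots.

(** * Polynomial identity from negative arguments, and splitting for symmetric matrices *)

Section Symmetric.
Variable R : rcfType.

(** This allows evaluation at [x < 0] only, where [n - x], [m - x] and the other quantities to be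
    divided by cannot vanish. *)
Lemma poly_eqN p q : (forall x : R, x < 0 -> p.[x] = q.[x]) -> p = q.
Proof.
move=> pq; apply/eqP; rewrite -subr_eq0; apply/negPn/negP => nz.
(* These are -1, -2, and so on: as many distinct roots as the size of [p - q], one more than its
   degree allows. *)
pose s : seq R := [seq - (i.+1%:R) | i <- iota 0 (size (p - q))].
have sU : uniq s.
  by rewrite map_inj_uniq ?iota_uniq // => i j /oppr_inj/eqP; rewrite eqr_nat => /eqP[].
suff sr : all (root (p - q)) s.
  by have := max_poly_roots nz sr sU; rewrite size_map size_iota ltnn.
apply/allP => x /mapP[i _ ->].
by rewrite rootE hornerD hornerN pq ?subrr // oppr_lt0 ltr0n.
Qed.

(** Over the complex extension of [R] the matrix becomes hermitian, hence unitarily diagonalisable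
    with a real diagonal. The factorisation descends because the embedding of [R] is injective on
    polynomials. *)
Lemma char_poly_sym n (A : 'M[R]_n) : A^T = A ->
  exists s : seq R, char_poly A = \prod_(a <- s) ('X - a%:P).
Proof.
move=> symA; pose f := real_complex R; pose B := map_mx f A.
have hB : B \is hermsymmx.
  apply: realsym_hermsym.
    by apply/is_hermitianmxP; rewrite expr0 scale1r map_mx_id // /B map_trmx symA.
  by apply/mxOverP => i j; rewrite mxE complex_real.
have /orthomx_spectralP defB := hermitian_normalmx hB.
have dR := hermitian_spectral_diag_real hB.
set P := spectralmx B in defB; set d := spectral_diag B in defB dR.
exists [seq complex.Re (d 0 i) | i <- enum 'I_n].
apply: (map_poly_inj f); rewrite rmorph_prod /= big_map big_enum /=.
pose Q := map_mx polyC P.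
have Qu : Q \in unitmx by rewrite map_unitmx spectral_unit.
have -> : map_poly f (char_poly A) = char_poly (diag_mx d).
  (* Similarity is used without inverses of polynomial matrices: from [P B = diag(d) P] follows
     [Q (X - B) = (X - diag(d)) Q], and [\det Q] is cancelled. *)
  rewrite map_char_poly -/B; apply: (@mulIr _ (\det Q)); first exact: Qu.
  rewrite mulrC -!det_mulmx /char_poly; congr (\det _).
  rewrite /char_poly_mx mulmxBr mulmxBl -scalar_mxC; congr (_ - _).
  rewrite -!map_mxM; congr map_mx.
  by rewrite {1}defB !mulmxA mulmxV ?spectral_unit // mul1mx.
rewrite char_poly_trig ?diag_mx_is_trig //; apply: eq_bigr => i _.
rewrite map_polyXsubC mxE eqxx mulr1n /=.
by rewrite RRe_real //; have /mxOverP := dR; apply.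
Qed.
End Symmetric.

(** * The Laplacian matrix: kernel vector, eigenvalue bounds, sorted spectrum *)

Lemma sum_enum_val (V : nmodType) (T : finType) (F : T -> V) :
  \sum_(i < #|T|) F (enum_val i) = \sum_x F x.
Proof.
rewrite (reindex (fun i : 'I_#|T| => enum_val i)) //=.
by apply: onW_bij; exact: enum_val_bij.
Qed.

Section Laplacian.
Variables (R : rcfType) (H : sgraph).
Local Notation L := (laplacian_mx R H).

Lemma degreeE (x : H) : (degree x)%:R = \sum_y (adj x y)%:R :> R.
Proof.
rewrite /degree -sum1dep_card natr_sum big_mkcond /=.
by apply: eq_bigr => y _; case: adj.
Qed.

Lemma laplacianE i j : L i j =
  (degree (enum_val i : H))%:R *+ (i == j) - (adj (enum_val i : H) (enum_val j))%:R.
Proof. by rewrite !mxE. Qed.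

Lemma laplacian_sym : L^T = L.
Proof.
apply/matrixP => i j; rewrite mxE !laplacianE adj_sym eq_sym.
by case: eqVneq => [->|].
Qed.

Lemma laplacian_const p : L *m const_mx 1 = 0 :> 'M_(_, p).
Proof.
apply/matrixP => i j; rewrite !mxE.
under eq_bigr do rewrite laplacianE mxE mulr1.
rewrite big_split /= sumrN (sum_enum_val (fun y => (adj (enum_val i) y)%:R)).
rewrite -degreeE (bigD1 i) //= eqxx mulr1n big1 ?addr0 ?subrr // => l.
by rewrite eq_sym => /negPf ->.
Qed.

(* Gershgorin's disc theorem, read at an entry of maximal modulus. *)
Lemma laplacian_eigenvalue a : eigenvalue L a ->
  exists x : H, `|a - (degree x)%:R| <= (degree x)%:R.
Proof.
case/eigenvalueP => v vL v0; have /rV0Pn[i0 vi0] := v0.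
pose j := [arg max_(j > i0) `|v 0 j|]%O.
have jmax i : `|v 0 i| <= `|v 0 j|.
  by rewrite /j; case: Order.TotalTheory.arg_maxP => // l _; apply.
have vj : 0 < `|v 0 j| by apply: lt_le_trans (jmax i0); rewrite normr_gt0.
exists (enum_val j); rewrite -(ler_pM2r vj) -normrM.
have /rowP/(_ j) := vL; rewrite !mxE.
under eq_bigr do rewrite laplacianE mulrBr.
rewrite big_split /= sumrN (bigD1 j) //= eqxx mulr1n big1 ?addr0; last first.
  by move=> l /negPf ->; rewrite mulr0.
move=> eqv; have -> : (a - (degree (enum_val j))%:R) * v 0 j =
    - \sum_i v 0 i * (adj (enum_val i) (enum_val j))%:R.
  by rewrite mulrBl -eqv; ring.
rewrite normrN degreeE -(sum_enum_val (fun y => (adj (enum_val j) y)%:R)) mulr_suml.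
apply: le_trans (ler_norm_sum _ _ _) _; apply: ler_sum => i _.
by rewrite normrM normr_nat mulrC adj_sym ler_wpM2l.
Qed.

Lemma char_poly_laplacian :
  char_poly L = \prod_(a <- laplacian_spectrum R H) ('X - a%:P).
Proof.
have [s def_s] := char_poly_sym laplacian_sym.
rewrite {1}def_s; apply/esym/perm_big.
by rewrite /laplacian_spectrum def_s perm_roots_mult_prod.
Qed.

Lemma size_laplacian_spectrum : size (laplacian_spectrum R H) = #|H|.
Proof.
by have := size_char_poly L; rewrite char_poly_laplacian size_prod_XsubC => -[].
Qed.

Lemma mem_laplacian_spectrum a : (a \in laplacian_spectrum R H) = eigenvalue L a.
Proof. by rewrite eigenvalue_root_char char_poly_laplacian root_prod_XsubC. Qed.

Lemma laplacian_spectrum_ge0 a : a \in laplacian_spectrum R H -> 0 <= a.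
Proof.
rewrite mem_laplacian_spectrum => /laplacian_eigenvalue[x].
by rewrite ler_norml => /andP[+ _]; rewrite lerBrDl subrr.
Qed.

Lemma laplacian_spectrum_le k a :
  regular H k -> a \in laplacian_spectrum R H -> a <= 2 * k%:R.
Proof.
rewrite mem_laplacian_spectrum => reg /laplacian_eigenvalue[x].
by rewrite reg ler_norml => /andP[_]; rewrite lerBlDr mulr_natl mulr2n.
Qed.

(** The all-ones vector has eigenvalue 0; no eigenvalue is negative and the list is sorted, so 0
    comes first. Since [lambda] reads position [i.-1], the indices from 2 on enumerate the tail. *)
Lemma laplacian_spectrumE : (0 < #|H|)%N ->
  laplacian_spectrum R H = 0 :: [seq lambda R H i | i <- index_iota 2 #|H|.+1].
Proof.
move=> H0; have sz := size_laplacian_spectrum.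
have z0 : 0 \in laplacian_spectrum R H.
  rewrite mem_laplacian_spectrum; apply/eigenvalueP.
  exists (const_mx 1); last first.
    by apply/rV0Pn; exists (Ordinal H0); rewrite mxE oner_eq0.
  apply: trmx_inj; rewrite trmx_mul laplacian_sym trmx_const laplacian_const.
  by rewrite scale0r trmx0.
have -> : [seq lambda R H i | i <- index_iota 2 #|H|.+1] =
   behead (laplacian_spectrum R H).
  apply: (@eq_from_nth _ 0); first by rewrite size_map size_iota size_behead sz subSS subn1.
  move=> i; rewrite size_map size_iota => lti.
  by rewrite (nth_map 0%N) ?size_iota // nth_iota // nth_behead /lambda.
have : sorted <=%R (laplacian_spectrum R H) by apply: sort_le_sorted.
have := laplacian_spectrum_ge0.
case: (laplacian_spectrum R H) z0 => //= b s z0 ge0.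
rewrite (path_sortedE le_trans) => /andP[/allP bs _].
congr (_ :: _); apply/eqP; rewrite eq_le ge0 ?mem_head // andbT.
by move: z0; rewrite inE => /predU1P[<-|/bs].
Qed.

End Laplacian.

(** * Determinant identities *)

Section Determinants.
Variable F : fieldType.

(** A change of enumeration permutes rows and columns by the same permutation, so the two signs
    cancel. It serves to put the vertices of the join into block order. *)
Lemma det_reindex (T : finType) M N (f : T -> T -> F)
    (e1 : 'I_M -> T) (e2 : 'I_N -> T) : bijective e1 -> bijective e2 ->
  \det (\matrix_(i, j) f (e1 i) (e1 j)) = \det (\matrix_(i, j) f (e2 i) (e2 j)).
Proof.
move=> b1 b2; have eMN : M = N.
  by rewrite -[M]card_ord -[N]card_ord (bij_eq_card b1) (bij_eq_card b2).
case: N / eMN e2 b2 => e2 [g e2K gK].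
have inj_s : injective (g \o e1) by apply: inj_comp (can_inj gK) (bij_inj b1).
pose s := perm inj_s.
have -> : \matrix_(i, j) f (e1 i) (e1 j)
    = row_perm s (col_perm s (\matrix_(i, j) f (e2 i) (e2 j))).
  by apply/matrixP => i j; rewrite !mxE !permE /= !gK.
by rewrite row_permE col_permE !det_mulmx !det_perm odd_permV mulrCA -signr_addb
           addbb mulr1.
Qed.

(** Sylvester's determinant identity, with powers of [b] on both sides so that [b = 0] needs no
    exception. One block matrix [K] is multiplied by a unitriangular matrix on the right, and by a
    triangular one of determinant [b ^+ m] on the left. *)
Lemma det_scalar_add_mulC n m (X : 'M[F]_(n, m)) (Y : 'M[F]_(m, n)) b :
  b ^+ n * \det (b%:M + Y *m X) = b ^+ m * \det (b%:M + X *m Y).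
Proof.
pose K := block_mx b%:M (- X) Y 1%:M.
have detK : \det K = \det (b%:M + X *m Y).
  have := det_mulmx K (block_mx 1%:M 0 (- Y) 1%:M).
  rewrite det_lblock !det1 !mulr1 => <-; rewrite mulmx_block.
  rewrite !mulmx1 mulmx0 !mul1mx mulmxN mulNmx opprK mulmx0 add0r subrr add0r.
  by rewrite det_ublock det1 mulr1.
have := det_mulmx (block_mx 1%:M 0 (- Y) b%:M) K.
rewrite det_lblock det1 mul1r det_scalar -detK => <-; rewrite mulmx_block.
rewrite !mul1mx !mul0mx !addr0 mulmxN !mulNmx opprK mulmx1 scalar_mxC addNr.
by rewrite det_ublock det_scalar addrC.
Qed.

Lemma mul_const_mx p q r (a b : F) :
  (const_mx a : 'M_(p, q)) *m (const_mx b : 'M_(q, r)) = const_mx (q%:R * (a * b)).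
Proof.
apply/matrixP => i j; rewrite !mxE; under eq_bigr do rewrite !mxE.
by rewrite sumr_const card_ord mulr_natl.
Qed.

Lemma const_mxZ p q (c : F) : const_mx c = c *: const_mx 1 :> 'M_(p, q).
Proof. by apply/matrixP => i j; rewrite !mxE mulr1. Qed.

(** As [M] sends the all-ones vector to [t] times itself, adding [e] to every entry amounts to
    multiplying [M] by a rank-one perturbation of the identity, of determinant [1 + n e / t]. No
    inverse of [M] is needed. *)
Lemma det_add_const n (M : 'M[F]_n) t e : t != 0 ->
  M *m const_mx 1 = const_mx t :> 'M_(n, 1) ->
  t * \det (M + const_mx e) = \det M * (t + n%:R * e).
Proof.
move=> t0 Mt; pose u : 'cV[F]_n := const_mx 1; pose v : 'rV[F]_n := const_mx (e / t).
have -> : M + const_mx e = M *m (1%:M + u *m v).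
  rewrite mulmxDr mulmx1 mulmxA Mt mul_const_mx; congr (_ + const_mx _).
  by field.
have := det_scalar_add_mulC u v 1; rewrite !expr1n !mul1r det_mulmx => <-.
rewrite mul_const_mx det_mx11 !mxE eqxx mulr1n.
by field.
Qed.
End Determinants.

(** * The incidence matrix and its two products with its transpose *)

Section Incidence.
Variable G : sgraph.

Lemma edgeP (a : edge G) : exists x y, adj x y /\ val a = [set x; y].
Proof.
have := valP a; rewrite inE => /existsP[x /existsP[y /andP[xy /eqP av]]].
by exists x, y.
Qed.

Lemma adj_neq (x y : G) : adj x y -> x != y.
Proof. by apply: contraTneq => ->; rewrite adj_irrefl. Qed.

Lemma card_edge (a : edge G) : #|val a| = 2.
Proof. by have [x [y [/adj_neq xy ->]]] := edgeP a; rewrite cards2 xy. Qed.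

Lemma edge_endpoints (a : edge G) x y : x != y -> x \in val a -> y \in val a ->
  adj x y /\ val a = [set x; y].
Proof.
have [u [v [uv ->]]] := edgeP a.
rewrite !inE => xy /pred2P[] ex /pred2P[] ey; subst x y; try by rewrite eqxx in xy.
  by [].
by rewrite adj_sym setUC.
Qed.

Variables (R : rcfType) (k : nat).

Definition incidence_mx : 'M[R]_(#|G|, #|edge G|) :=
  \matrix_(i, j) (enum_val i \in val (enum_val j : edge G))%:R.
Local Notation B := incidence_mx.

(** The only edge that can contain two distinct vertices is the pair formed by them. *)
Lemma sum_edge_mem2 (x y : G) : x != y ->
  \sum_(a : edge G) (x \in val a)%:R * (y \in val a)%:R = (adj x y)%:R :> R.
Proof.
move=> xy; case: (boolP (adj x y)) => [axy|naxy].
  have eP : [set x; y] \in edge_set G.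
    by rewrite inE; apply/existsP; exists x; apply/existsP; exists y; rewrite axy eqxx.
  pose a0 : edge G := exist _ [set x; y] eP.
  rewrite (bigD1 a0) //= !inE !eqxx orbT mulr1 big1 ?addr0 // => a.
  case: (boolP (x \in val a)) => xa; last by rewrite mul0r.
  case: (boolP (y \in val a)) => ya; last by rewrite mulr0.
  by have [_ av] := edge_endpoints xy xa ya; rewrite -val_eqE /= av eqxx.
rewrite big1 // => a _.
case: (boolP (x \in val a)) => xa; last by rewrite mul0r.
case: (boolP (y \in val a)) => ya; last by rewrite mulr0.
by have [axy _] := edge_endpoints xy xa ya; rewrite axy in naxy.
Qed.

(** Double counting: each neighbour of [x] is replaced by the sum over the edges joining it to [x],
    and each edge at [x] has exactly one other endpoint. *)
Lemma sum_edge_mem (x : G) :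
  \sum_(a : edge G) (x \in val a)%:R = (degree x)%:R :> R.
Proof.
rewrite degreeE (bigD1 x) //= adj_irrefl add0r.
under [RHS]eq_bigr => y; first by rewrite eq_sym => /sum_edge_mem2 <-; over.
rewrite exchange_big /=; apply: eq_bigr => a _; rewrite -mulr_sumr.
case: (boolP (x \in val a)) => xa; last by rewrite mul0r.
rewrite mul1r; have := card_edge a; rewrite (cardD1 x) xa add1n => -[ca].
transitivity (#|[predD1 val a & x]|%:R : R); first by rewrite ca.
rewrite -sum1_card natr_sum big_mkcond [RHS]big_mkcond.
apply: eq_bigr => y _; rewrite !inE; case: eqP => //= _.
by case: (y \in _).
Qed.

Lemma sum_mem_edge (a : edge G) : \sum_(x : G) (x \in val a)%:R = 2 :> R.
Proof.
transitivity (#|val a|%:R : R); last by rewrite card_edge.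
rewrite -sum1_card natr_sum [RHS]big_mkcond /=.
by apply: eq_bigr => x _; case: (_ \in _).
Qed.

(** Two distinct edges share at most one vertex, since an edge is determined by its endpoints; an
    edge shares two vertices with itself. *)
Lemma sum_mem2_edge (a b : edge G) :
  \sum_(x : G) (x \in val a)%:R * (x \in val b)%:R
  = (total_adj (inr a) (inr b))%:R + 2 *+ (a == b) :> R.
Proof.
rewrite /=; case: eqVneq => [<-|ab] /=.
  rewrite add0r -(sum_mem_edge a); apply: eq_bigr => x _.
  by case: (_ \in _); rewrite ?mul1r ?mul0r.
have -> : \sum_x (x \in val a)%:R * (x \in val b)%:R = #|val a :&: val b|%:R :> R.
  rewrite -sum1_card natr_sum [RHS]big_mkcond /=.
  by apply: eq_bigr => x _; rewrite inE; do 2!case: (_ \in _); rewrite ?mulr0 ?mulr1.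
rewrite addr0 -card_gt0; case def_n: #|_| => [|[|i]] //.
have /card_gt1P[x [y [+ + xy]]] : (1 < #|val a :&: val b|)%N by rewrite def_n.
rewrite !inE => /andP[xa xb] /andP[ya yb]; case/eqP: ab; apply: val_inj.
by have [_ ->] := edge_endpoints xy xa ya; have [_ ->] := edge_endpoints xy xb yb.
Qed.

Lemma incidence_const p : regular G k -> B *m const_mx 1 = const_mx k%:R :> 'M_(_, p).
Proof.
move=> reg; apply/matrixP => i j; rewrite !mxE.
under eq_bigr do rewrite !mxE mulr1.
by rewrite (sum_enum_val (fun a : edge G => (enum_val i \in val a)%:R)) sum_edge_mem reg.
Qed.

Lemma tr_incidence_const p : B^T *m const_mx 1 = const_mx 2 :> 'M_(_, p).
Proof.
apply/matrixP => i j; rewrite !mxE.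
under eq_bigr do rewrite !mxE mulr1.
by rewrite (sum_enum_val (fun x : G => (x \in val (enum_val i))%:R)) sum_mem_edge.
Qed.

Lemma incidence_mul_tr : regular G k -> B *m B^T = (2 * k%:R)%:M - laplacian_mx R G.
Proof.
move=> reg; apply/matrixP => i j; rewrite !mxE.
under eq_bigr do rewrite !mxE.
rewrite (sum_enum_val (fun a : edge G => (enum_val i \in val a)%:R * (enum_val j \in val a)%:R)).
rewrite reg; case: eqVneq => [->|ij].
  under eq_bigr do rewrite -natrM mulnb andbb.
  by rewrite sum_edge_mem reg adj_irrefl !mulr1n mulr0n; ring.
by rewrite sum_edge_mem2 ?(inj_eq enum_val_inj) ?mulr0n //; ring.
Qed.

(** The adjacency matrix of the line graph of [G], read off as the part of the total graph induced
    on the edges. *)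
Definition line_mx : 'M[R]_#|edge G| :=
  \matrix_(i, j) (total_adj (inr (enum_val i : edge G)) (inr (enum_val j : edge G)))%:R.

Lemma tr_incidence_mul : B^T *m B = line_mx + 2%:M.
Proof.
apply/matrixP => i j; rewrite !mxE.
under eq_bigr do rewrite !mxE.
rewrite (sum_enum_val (fun x : G => (x \in val (enum_val i))%:R * (x \in val (enum_val j))%:R)).
by rewrite sum_mem2_edge (inj_eq enum_val_inj).
Qed.

(** The sum of all entries of [B] is computed by rows and by columns. *)
Lemma handshake : regular G k -> #|G|%:R * k%:R = 2 * #|edge G|%:R :> R.
Proof.
move=> reg; have : const_mx 1 *m (B *m const_mx 1) = (const_mx 1 *m B) *m const_mx 1 :> 'M_1.
  by rewrite mulmxA.
rewrite incidence_const // -[const_mx 1 *m B]trmxK trmx_mul trmx_const tr_incidence_const.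
by rewrite trmx_const !mul_const_mx => /matrixP/(_ 0 0); rewrite !mxE mul1r mulr1 [RHS]mulrC.
Qed.
End Incidence.

(** * The characteristic polynomial of the join as a block determinant *)

Lemma horner_char_poly (F : comNzRingType) n (A : 'M[F]_n) x :
  (char_poly A).[x] = \det (x%:M - A).
Proof.
rewrite -horner_evalE -det_map_mx; congr (\det _); apply/matrixP => i j.
by rewrite !mxE rmorphB rmorphMn /= !horner_evalE hornerX hornerC.
Qed.

Section SumEnumeration.
Variables S T : finType.

(** Unlike [enum_val] on a sum type, this enumeration follows [lshift] and [rshift], hence the
    layout of [block_mx]. *)
Definition sum_enum_fun (M N : nat) (f : 'I_M -> S) (g : 'I_N -> T)
    (i : 'I_(M + N)) : S + T :=
  match split i with inl j => inl (f j) | inr j => inr (g j) end.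

Lemma sum_enum_fun_bij M N (f : 'I_M -> S) (g : 'I_N -> T) :
  bijective f -> bijective g -> bijective (sum_enum_fun f g).
Proof.
move=> [f' fK Kf] [g' gK Kg].
exists (fun u => unsplit (match u with inl s => inl (f' s) | inr t => inr (g' t) end)).
  by move=> i; rewrite /sum_enum_fun -[RHS]splitK; case: split => j; rewrite ?fK ?gK.
by case=> u; rewrite /sum_enum_fun unsplitK ?Kf ?Kg.
Qed.

Lemma sum_enum_fun_l M N (f : 'I_M -> S) (g : 'I_N -> T) i :
  sum_enum_fun f g (lshift N i) = inl (f i).
Proof. by rewrite /sum_enum_fun (unsplitK (inl i)). Qed.

Lemma sum_enum_fun_r M N (f : 'I_M -> S) (g : 'I_N -> T) i :
  sum_enum_fun f g (rshift M i) = inr (g i).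
Proof. by rewrite /sum_enum_fun (unsplitK (inr i)). Qed.
End SumEnumeration.

Section Join.
Variables (R : rcfType) (G G1 G2 : sgraph) (k : nat).
Hypothesis reg : regular G k.
Local Notation H := (total_double_join G G1 G2).
Local Notation B := (incidence_mx G R).
Local Notation n := #|G|.
Local Notation m := #|edge G|.
Local Notation n1 := #|G1|.
Local Notation n2 := #|G2|.

Lemma sum_true (T : finType) : \sum_(x : T) true%:R = #|T|%:R :> R.
Proof. by rewrite -natr_sum sum1_card. Qed.

Lemma sum_false (T : finType) : \sum_(x : T) false%:R = 0 :> R.
Proof. exact: big1_eq. Qed.

Lemma degree_vertex (x : G) : (degree (inl (inl x) : H))%:R = 2 * k%:R + n1%:R :> R.
Proof.
rewrite degreeE !big_sumType /= sum_true sum_false -degreeE sum_edge_mem reg.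
by ring.
Qed.

(** The line graph is [2k - 2] regular: each of the two endpoints of [a] lies on [k] edges, and [a]
    itself is counted twice. The subtraction takes place in [R], not in [nat]. *)
Lemma sum_line_adj (a : edge G) :
  \sum_b (total_adj (inr a) (inr b))%:R = 2 * k%:R - 2 :> R.
Proof.
have -> : 2 * k%:R = \sum_(b : edge G) \sum_(x : G) (x \in val a)%:R * (x \in val b)%:R :> R.
  rewrite exchange_big /= -(sum_mem_edge R a) mulr_suml; apply: eq_bigr => x _.
  by rewrite -mulr_sumr sum_edge_mem reg.
under [\sum_b \sum_x _]eq_bigr do rewrite sum_mem2_edge.
rewrite big_split /= [X in _ = _ + X - _](bigD1 a) //= eqxx mulr1n.
rewrite [X in _ = _ + (_ + X) - _]big1 ?addr0 ?addrK // => b.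
by rewrite eq_sym => /negPf ->.
Qed.

Lemma degree_edge (a : edge G) : (degree (inl (inr a) : H))%:R = 2 * k%:R + n2%:R :> R.
Proof.
rewrite degreeE !big_sumType /= sum_true sum_false (sum_mem_edge R a).
by rewrite (sum_line_adj a); ring.
Qed.

Lemma degree_left (y : G1) : (degree (inr (inl y) : H))%:R = n%:R + (degree y)%:R :> R.
Proof.
by rewrite degreeE !big_sumType /= sum_true !sum_false -degreeE !addr0.
Qed.

Lemma degree_right (y : G2) : (degree (inr (inr y) : H))%:R = m%:R + (degree y)%:R :> R.
Proof.
by rewrite degreeE !big_sumType /= sum_true !sum_false -degreeE !add0r.
Qed.

(** Blocks are ordered as vertices of [G], edges of [G], [G1], [G2]. Regularity replaces the
    adjacency matrix of [G] by [k - L], and that of the line graph is [B^T B - 2], which gives the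
    scalars in the diagonal blocks. *)
Lemma det_join_block x :
  (char_poly (laplacian_mx R H)).[x] = \det (block_mx
    (block_mx ((x - k%:R - n1%:R)%:M - laplacian_mx R G) B
              B^T ((x - 2 * k%:R - n2%:R - 2)%:M + B^T *m B))
    (block_mx (const_mx 1) 0 0 (const_mx 1))
    (block_mx (const_mx 1) 0 0 (const_mx 1))
    (block_mx ((x - n%:R)%:M - laplacian_mx R G1) 0
              0 ((x - m%:R)%:M - laplacian_mx R G2))).
Proof.
pose f (u v : H) : R := x *+ (u == v) - ((degree u)%:R *+ (u == v) - (adj u v)%:R).
pose e := sum_enum_fun
  (sum_enum_fun (fun i : 'I_#|G| => enum_val i) (fun i : 'I_#|edge G| => enum_val i))
  (sum_enum_fun (fun i : 'I_#|G1| => enum_val i) (fun i : 'I_#|G2| => enum_val i)).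
rewrite horner_char_poly.
transitivity (\det (\matrix_(i < #|H|, j < #|H|) f (enum_val i) (enum_val j))).
  by congr (\det _); apply/matrixP => i j; rewrite !mxE /f (inj_eq enum_val_inj).
rewrite (@det_reindex _ _ _ _ _ _ e (@enum_val_bij H)); last first.
  by rewrite /e; do !apply: sum_enum_fun_bij; exact: enum_val_bij.
congr (\det _); rewrite tr_incidence_mul; apply/matrixP => i j; rewrite mxE /e.
have eqll (S T : eqType) (u v : S) : (inl u == inl v :> S + T) = (u == v) by [].
have eqrr (S T : eqType) (u v : T) : (inr u == inr v :> S + T) = (u == v) by [].
have eqE := (sum_enum_fun_l, sum_enum_fun_r, block_mxEul, block_mxEur, block_mxEdl, block_mxEdr).
have [i' ->|i' ->] := split_ordP i; have [i'' ->|i'' ->] := split_ordP i';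
have [j' ->|j' ->] := split_ordP j; have [j'' ->|j'' ->] := split_ordP j';
rewrite !eqE !mxE /f ?eqll ?eqrr ?eqll ?(inj_eq enum_val_inj) /= ?mulr0n ?sub0r ?opprK ?oppr0 //.
- by rewrite degree_vertex reg; case: (i'' == j''); rewrite ?mulr0n ?mulr1n; ring.
- by rewrite degree_edge; case: (i'' == j''); rewrite ?mulr0n ?mulr1n; ring.
- by rewrite degree_left; case: (i'' == j''); rewrite ?mulr0n ?mulr1n; ring.
- by rewrite degree_right; case: (i'' == j''); rewrite ?mulr0n ?mulr1n; ring.
Qed.
End Join.

(** * Elimination of the edges, and determinants of quadratics in the Laplacian *)

(** Right multiplication by the block column of [W] and [Y] clears the lower left block. This
    replaces the Schur complement and requires no inverse of [Adr]. *)
Lemma det_block_elim (F : comNzRingType) p q (Aul W : 'M[F]_p) (Aur : 'M_(p, q))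
    (Adl Y : 'M_(q, p)) (Adr : 'M_q) : Adl *m W + Adr *m Y = 0 ->
  \det (block_mx Aul Aur Adl Adr) * \det W = \det (Aul *m W + Aur *m Y) * \det Adr.
Proof.
move=> E; have := det_mulmx (block_mx Aul Aur Adl Adr) (block_mx W 0 Y 1%:M).
by rewrite mulmx_block !mulmx0 !mulmx1 E !add0r det_ublock det_lblock det1 mulr1 => ->.
Qed.

Section Blocks.
Variables (R : rcfType) (G : sgraph) (k : nat).
Hypothesis reg : regular G k.
Hypothesis G0 : (0 < #|G|)%N.
Hypothesis le_nm : (#|G| <= #|edge G|)%N.
Local Notation L := (laplacian_mx R G).
Local Notation B := (incidence_mx G R).
Local Notation n := #|G|.
Local Notation m := #|edge G|.

Lemma scalar_sub_laplacian_const (H : sgraph) p (t c : R) :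
  (t%:M - laplacian_mx R H) *m const_mx c = const_mx (t * c) :> 'M_(_, p).
Proof.
rewrite const_mxZ -scalemxAr mulmxBl laplacian_const subr0 mul_scalar_mx scalerA mulrC.
by rewrite [RHS]const_mxZ.
Qed.

Lemma const_mul_tr_incidence p (c : R) :
  const_mx c *m B^T = const_mx (k%:R * c) :> 'M_(p, _).
Proof.
rewrite const_mxZ; apply: trmx_inj; rewrite trmx_mul trmxK linearZ /= trmx_const -scalemxAr.
rewrite (incidence_const _ _ reg).
by apply/matrixP => i j; rewrite !mxE mulrC.
Qed.

Lemma tr_incidence_mul_const p (c : R) :
  B^T *m const_mx c = const_mx (2 * c) :> 'M_(_, p).
Proof.
rewrite const_mxZ -scalemxAr tr_incidence_const.
by apply/matrixP => i j; rewrite !mxE mulrC.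
Qed.

Lemma const_mul_laplacian p (c : R) : const_mx c *m L = 0 :> 'M_(p, _).
Proof.
apply: trmx_inj; rewrite trmx_mul laplacian_sym trmx_const trmx0.
have := scalar_sub_laplacian_const G p 0 c; rewrite mul0r raddf0 sub0r mulNmx.
by move/(canRL (@opprK _)) => ->; apply/matrixP => i j; rewrite !mxE oppr0.
Qed.

Lemma det_scalar_sub_laplacian (t : R) :
  \det (t%:M - L) = \prod_(a <- laplacian_spectrum R G) (t - a).
Proof.
rewrite -horner_char_poly char_poly_laplacian horner_prod.
by apply: eq_bigr => a _; rewrite hornerXsubC.
Qed.

Lemma det_incidence_block (al be c d : R) :
  be != 0 -> be + 2 * k%:R < 0 -> be + 2 * k%:R + d * m%:R < 0 ->
  \det (block_mx (al%:M - L + const_mx c) B B^T (be%:M + B^T *m B + const_mx d))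
  = be ^+ (m - n) * \det ((al%:M - L) *m ((be + 2 * k%:R)%:M - L) - ((2 * k%:R)%:M - L)
     + const_mx (al * (d * k%:R / 2) + c * (be + 2 * k%:R) + n%:R * (c * (d * k%:R / 2)))).
Proof.
set t := be + 2 * k%:R => be0 t0 td0.
(* If N is the lower right block then N B^T = B^T W, so right multiplication by
   the block column (W, - B^T) clears the lower left block. *)
pose W := t%:M - L + const_mx (d * k%:R / 2).
have BB := incidence_mul_tr R reg.
have WE : W = be%:M + B *m B^T + const_mx (d * k%:R / 2).
  by rewrite BB /W /t raddfD /= !addrA.
(* On the all-ones vector [W] takes the value [t + d m], by the handshake identity; on the remaining
   spectrum its factors are [t - a] with [a >= 0]. All these are negative. *)
have detW : \det W != 0.
  suff : t * \det W != 0 by rewrite mulf_eq0 negb_or => /andP[].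
  rewrite (det_add_const _ (t := t)) ?(lt_eqF t0) //; last first.
    by rewrite scalar_sub_laplacian_const mulr1.
  rewrite mulf_neq0 //; last first.
    rewrite lt_eqF //; suff -> : n%:R * (d * k%:R / 2) = d * m%:R :> R by [].
    transitivity (d / 2 * (n%:R * k%:R)); first by ring.
    by rewrite (handshake R reg); field.
  rewrite det_scalar_sub_laplacian prodf_seq_neq0; apply/allP => a /laplacian_spectrum_ge0 a0.
  by rewrite /= lt_eqF //; lra.
(* The constant matrix is absorbed into one factor: [B^T (B + d/2) = B^T B + d], while
   [(B + d/2) B^T = B B^T + d k / 2], where scalars stand for constant matrices. *)
have detN : \det (be%:M + B^T *m B + const_mx d) = be ^+ (m - n) * \det W.
  have := det_scalar_add_mulC (B + const_mx (d / 2)) B^T be.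
  rewrite mulmxDr tr_incidence_mul_const mulmxDl const_mul_tr_incidence !addrA.
  rewrite -[in be ^+ m](subnK le_nm) addnC exprD -mulrA => /mulfI.
  rewrite expf_neq0 // => /(_ isT).
  have -> : 2 * (d / 2) = d by field.
  by rewrite WE; have -> : k%:R * (d / 2) = d * k%:R / 2 by field.
apply: (mulIf detW); rewrite (@det_block_elim _ _ _ _ _ _ _ (- B^T)); last first.
  rewrite WE !mulmxN mulmxDr !mulmxDl mulmxDr mul_mx_scalar mul_scalar_mx mulmxA.
  rewrite const_mul_tr_incidence tr_incidence_mul_const.
  have -> : 2 * (d * k%:R / 2) = k%:R * d by field.
  by rewrite subrr.
rewrite detN mulrCA mulrA; congr (_ * _); congr (_ * \det _).
rewrite mulmxN BB mulmxDl /W !mulmxDr scalar_sub_laplacian_const mul_const_mx.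
rewrite [const_mx c *m t%:M]mul_mx_scalar [const_mx c *m - L]mulmxN const_mul_laplacian.
move: (_%:M - L) (_ *m - L) (_ *m t%:M) => X1 X2 X3.
by apply/matrixP => i j; rewrite !mxE; ring.
Qed.

(** The quadratic in [L] splits as [(s1 - L) (s2 - L)] and acts on the all-ones vector as
    [s1 s2 = u v - 2k], which is positive. Adding the constant matrix therefore changes only the
    factor of the eigenvalue 0. *)
Lemma det_quadratic_laplacian (u v e : R) :
  u < 0 -> v < 0 -> 2 * k%:R < u * v ->
  \det ((u%:M - L) *m (v%:M - L) - ((2 * k%:R)%:M - L) + const_mx e)
  = (u * v - 2 * k%:R + n%:R * e) *
    \prod_(i <- index_iota 2 n.+1)
      ((u - lambda R G i) * (v - lambda R G i) - (2 * k%:R - lambda R G i)).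
Proof.
move=> u0 v0 uvk; have k0 : 0 <= k%:R :> R by apply: ler0n.
(* The discriminant of [y^2 - (u + v - 1) y + (u v - 2k)], whose roots are [s1] and [s2]. *)
pose D := (u + v - 1) ^+ 2 - 4 * (u * v - 2 * k%:R).
have D0 : 0 <= D.
  have -> : D = (u - v) ^+ 2 + (1 - 2 * u - 2 * v + 8 * k%:R) by rewrite /D; ring.
  by have := sqr_ge0 (u - v); lra.
have sD := sqr_sqrtr D0.
pose s1 := (u + v - 1 + Num.sqrt D) / 2; pose s2 := (u + v - 1 - Num.sqrt D) / 2.
have sum_s : s1 + s2 = u + v - 1 by rewrite /s1 /s2; field.
have prod_s : s1 * s2 = u * v - 2 * k%:R.
  have -> : s1 * s2 = ((u + v - 1) ^+ 2 - Num.sqrt D ^+ 2) / 4 by rewrite /s1 /s2; field.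
  by rewrite sD /D; field.
have -> : (u%:M - L) *m (v%:M - L) - ((2 * k%:R)%:M - L) = (s1%:M - L) *m (s2%:M - L).
  rewrite !mulmxBr !mulmxBl !mul_scalar_mx !mul_mx_scalar !scale_scalar_mx prod_s.
  have -> : s1 = u + v - 1 - s2 by rewrite -sum_s addrK.
  move: (L *m L) => LL; apply/matrixP => i j; rewrite !mxE.
  by case: (i == j); rewrite ?mulr0n ?mulr1n; ring.
have p0 : s1 * s2 != 0 by rewrite prod_s gt_eqF //; lra.
apply: (mulfI p0); rewrite (det_add_const _ p0); last first.
  by rewrite -mulmxA !scalar_sub_laplacian_const mulr1.
rewrite mulrC prod_s [RHS]mulrCA; congr (_ * _); rewrite det_mulmx !det_scalar_sub_laplacian.
rewrite laplacian_spectrumE // !big_cons !subr0 mulrACA prod_s; congr (_ * _).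
rewrite !big_map -big_split /=; apply: eq_bigr => i _.
rewrite mulrBr !mulrBl prod_s.
have -> : s1 = u + v - 1 - s2 by rewrite -sum_s addrK.
by ring.
Qed.
End Blocks.

(** * Evaluation and factorisation of the characteristic polynomial of the join *)

Section CharPolyJoin.
Variables (R : rcfType) (G G1 G2 : sgraph) (k : nat).
Hypothesis reg : regular G k.
Hypothesis G0 : (0 < #|G|)%N.
Hypothesis le_nm : (#|G| <= #|edge G|)%N.
Local Notation n := #|G|.
Local Notation m := #|edge G|.
Local Notation n1 := #|G1|.
Local Notation n2 := #|G2|.
Local Notation H := (total_double_join G G1 G2).

Lemma horner_char_poly_join (x : R) : x < 0 ->
  (char_poly (laplacian_mx R H)).[x] =
  (x - 2 * k%:R - n2%:R - 2) ^+ (m - n)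
  * ((x - k%:R - n1%:R + n%:R * n1%:R / (n%:R - x)) * (x - n2%:R - 2 + m%:R * n2%:R / (m%:R - x))
     - 2 * k%:R)
  * (\prod_(i <- index_iota 2 n.+1)
      ((x - k%:R - n1%:R - lambda R G i) * (x - n2%:R - 2 - lambda R G i)
       - (2 * k%:R - lambda R G i)))
  * (\prod_(a <- laplacian_spectrum R G1) (x - n%:R - a)
     * \prod_(a <- laplacian_spectrum R G2) (x - m%:R - a)).
Proof.
move=> x0.
have [kp np mp n1p n2p] :
    [/\ 0 <= k%:R :> R, 0 <= n%:R :> R, 0 <= m%:R :> R, 0 <= n1%:R :> R & 0 <= n2%:R :> R].
  by split; apply: ler0n.
have xn : n%:R - x != 0 by rewrite gt_eqF //; lra.
have xm : m%:R - x != 0 by rewrite gt_eqF //; lra.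
have xn' : x - n%:R != 0 by rewrite lt_eqF //; lra.
have xm' : x - m%:R != 0 by rewrite lt_eqF //; lra.
rewrite (det_join_block _ _ reg) -[LHS]mulr1 -[X in _ * X](det1 R (n + m)).
(* Here [W] is the identity. The rows of [x - n - L(G1)] sum to [x - n], so a constant block
   [1 / (n - x)] cancels the all-ones block; likewise for [G2] with [m]. The effect is to add
   [n1 / (n - x)] and [n2 / (m - x)] to all entries of the vertex and edge blocks. *)
rewrite (@det_block_elim _ _ _ _ _ _ _
  (block_mx (const_mx (n%:R - x)^-1) 0 0 (const_mx (m%:R - x)^-1))); last first.
  rewrite mulmx1 mulmx_block !mulmx0 !mul0mx !addr0 !add0r !scalar_sub_laplacian_const.
  have -> : (x - n%:R) / (n%:R - x) = -1 by field.
  have -> : (x - m%:R) / (m%:R - x) = -1 by field.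
  rewrite add_block_mx !addr0 -[RHS]block_mx0; congr block_mx.
    by apply/matrixP => i j; rewrite !mxE subrr.
  by apply/matrixP => i j; rewrite !mxE subrr.
rewrite mulmx1 mulmx_block !mulmx0 !mul0mx !addr0 !add0r !mul_const_mx !mul1r.
rewrite add_block_mx !addr0.
rewrite det_ublock !det_scalar_sub_laplacian; congr (_ * _).
set be := x - 2 * k%:R - _ - 2.
have vE : be + 2 * k%:R = x - n2%:R - 2 by rewrite /be; ring.
rewrite (det_incidence_block reg) //; last first.
- rewrite vE; suff : n2%:R / (m%:R - x) * m%:R <= n2%:R :> R by lra.
  by rewrite mulrAC ler_pdivrMr ?ler_wpM2l //; lra.
- by rewrite vE; lra.
- by rewrite lt_eqF // /be; lra.
have u0 : x - k%:R - n1%:R < 0 by lra.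
have v0 : x - n2%:R - 2 < 0 by lra.
have uv : 2 * k%:R < (x - k%:R - n1%:R) * (x - n2%:R - 2).
  rewrite -subr_gt0; set u := (X in 0 < X).
  have -> : u = (k%:R + n1%:R - x) * (n2%:R - x) + 2 * (n1%:R - x) by rewrite /u; ring.
  by rewrite addr_gt0 ?mulr_gt0 //; lra.
rewrite vE (det_quadratic_laplacian G0 _ u0 v0 uv).
rewrite mulrA; congr (_ * _ * _).
(* Replacing [n k / 2] by [m] is what lets the factor of the eigenvalue 0 regroup as a product minus
   [2k]. *)
have hs := handshake R reg; set c := n1%:R / _; set d := n2%:R / _.
transitivity ((x - k%:R - n1%:R) * (x - n2%:R - 2) - 2 * k%:R + (n%:R * k%:R) / 2 *
    ((x - k%:R - n1%:R) * d + n%:R * c * d) + n%:R * c * (x - n2%:R - 2)); first by ring.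
by rewrite hs /c /d; field; rewrite xm.
Qed.

Lemma char_poly_join : (0 < n1)%N -> (0 < n2)%N ->
  char_poly (laplacian_mx R H) =
  (\prod_(a <-
     [seq lambda R G1 i + n%:R | i <- index_iota 2 n1.+1]
     ++ [seq lambda R G2 i + m%:R | i <- index_iota 2 n2.+1]
     ++ [seq (n1%:R + 2 * lambda R G i + k%:R + n2%:R + 2
              + Num.sqrt ((n1%:R + k%:R - n2%:R - 2) ^+ 2
                          + 4 * (2 * k%:R - lambda R G i))) / 2
         | i <- index_iota 2 n.+1]
     ++ [seq (n1%:R + 2 * lambda R G i + k%:R + n2%:R + 2
              - Num.sqrt ((n1%:R + k%:R - n2%:R - 2) ^+ 2
                          + 4 * (2 * k%:R - lambda R G i))) / 2
         | i <- index_iota 2 n.+1]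
     ++ nseq (m - n) (n2%:R + 2 * k%:R + 2)) ('X - a%:P))
  * ('X * ('X^3
             - (m%:R + n%:R + n1%:R + k%:R + n2%:R + 2) *: 'X^2
             + (2 * m%:R + (n1%:R + k%:R + n%:R) * (m%:R + n2%:R + 2)
                + n%:R * k%:R - 2 * k%:R) *: 'X
             + (2 * (n%:R + m%:R) * k%:R
                - 2 * (n1%:R + k%:R + n%:R) * m%:R
                - n%:R * k%:R * (m%:R + n2%:R + 2))%:P)).
Proof.
move=> n1_gt0 n2_gt0; apply: poly_eqN => x x0.
rewrite horner_char_poly_join // hornerM horner_prod.
under [in RHS]eq_bigr do rewrite hornerXsubC.
rewrite !big_cat !big_map big_nseq iter_mulr_1 !laplacian_spectrumE // !big_cons !big_map.
have shift (H' : sgraph) (c : R) I : \prod_(i <- I) (x - (lambda R H' i + c))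
    = \prod_(i <- I) (x - c - lambda R H' i).
  by apply: eq_bigr => i _; ring.
rewrite !shift /=; set P1 := \prod_(i <- _) (x - n%:R - _).
set P2 := \prod_(i <- _) (x - m%:R - _).
set P3 := \prod_(i <- _) (_ - (2 * _ - _)).
set P4 := \prod_(i <- _) (x - (_ + Num.sqrt _) / 2).
set P5 := \prod_(i <- _) (x - (_ - Num.sqrt _) / 2).
(* Each factor is completed to a square in [x]. The bound [lambda <= 2k] makes [D] nonnegative;
   otherwise [Num.sqrt D] would be 0 and would not square to [D]. *)
have -> : P3 = P4 * P5.
  rewrite /P3 /P4 /P5 -big_split /= !big_seq; apply: eq_bigr => i iI.
  have li : lambda R G i <= 2 * k%:R.
    apply: laplacian_spectrum_le reg _; rewrite laplacian_spectrumE // inE.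
    by rewrite (map_f (lambda R G)) ?orbT.
  set D := (_ ^+ 2 + _); have D0 : 0 <= D.
    by rewrite addr_ge0 ?sqr_ge0 // mulr_ge0 // subr_ge0.
  set s := Num.sqrt D; have sD : s ^+ 2 = D by rewrite sqr_sqrtr.
  set q := n1%:R + _ + _ + _ + _.
  transitivity ((x - q / 2) ^+ 2 - s ^+ 2 / 4); last by field.
  by rewrite sD /D /q; field.
have -> : x - (n2%:R + 2 * k%:R + 2) = x - 2 * k%:R - n2%:R - 2 by ring.
rewrite !hornerE /=.
have [xn xm] : n%:R - x != 0 /\ m%:R - x != 0.
  have [np mp] : 0 <= n%:R :> R /\ 0 <= m%:R :> R by split; apply: ler0n.
  by split; rewrite gt_eqF //; lra.
move: (_ ^+ (m - n)) P1 P2 P4 P5 => p0 p1 p2 p4 p5.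
(* The factors [x - n] and [x - m], from the eigenvalue 0 of [G1] and of [G2], clear the two
   denominators and yield the quartic. *)
by field; rewrite xm.
Qed.
End CharPolyJoin.

Theorem theorem8 (R : rcfType) (G G1 G2 : sgraph) (k n m n1 n2 : nat)
    (Gconn : connected_graph G) (Greg : regular G k)
    (Gn : #|G| = n) (Gm : #|edge G| = m) (le_nm : (n <= m)%N)
    (G1n : #|G1| = n1) (n1_ge1 : (1 <= n1)%N)
    (G2n : #|G2| = n2) (n2_ge1 : (1 <= n2)%N) :
  perm_eq (laplacian_spectrum R (total_double_join G G1 G2))
    ([seq lambda R G1 i + n%:R | i <- index_iota 2 n1.+1]
     ++ [seq lambda R G2 i + m%:R | i <- index_iota 2 n2.+1]
     ++ [seq (n1%:R + 2 * lambda R G i + k%:R + n2%:R + 2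
              + Num.sqrt ((n1%:R + k%:R - n2%:R - 2) ^+ 2
                          + 4 * (2 * k%:R - lambda R G i))) / 2
         | i <- index_iota 2 n.+1]
     ++ [seq (n1%:R + 2 * lambda R G i + k%:R + n2%:R + 2
              - Num.sqrt ((n1%:R + k%:R - n2%:R - 2) ^+ 2
                          + 4 * (2 * k%:R - lambda R G i))) / 2
         | i <- index_iota 2 n.+1]
     ++ nseq (m - n) (n2%:R + 2 * k%:R + 2)
     ++ roots_mult
          ('X * ('X^3
             - (m%:R + n%:R + n1%:R + k%:R + n2%:R + 2) *: 'X^2
             + (2 * m%:R + (n1%:R + k%:R + n%:R) * (m%:R + n2%:R + 2)
                + n%:R * k%:R - 2 * k%:R) *: 'X
             + (2 * (n%:R + m%:R) * k%:R
                - 2 * (n1%:R + k%:R + n%:R) * m%:R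
                - n%:R * k%:R * (m%:R + n2%:R + 2))%:P))).
Proof.
subst n m n1 n2; case: Gconn => G0 _.
have E := char_poly_join R Greg G0 le_nm n1_ge1 n2_ge1.
(* A monic product is nonzero, hence so are both factors; this matters because [roots_mult] of the
   zero polynomial is empty. *)
have := monic_neq0 (char_poly_monic (laplacian_mx R (total_double_join G G1 G2))).
rewrite /laplacian_spectrum E mulf_eq0 negb_or => /andP[p0 q0].
apply: (perm_trans (perm_roots_multM p0 q0)).
by rewrite !catA perm_cat2r perm_roots_mult_prod.
Qed.
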